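(* For every integer $\Delta\geq 5$ and every integer $k$, there exists a $\Delta$-regular graph with slope-number greater than $k$. (That is, for all $\Delta\ge 5$ there exist $\Delta$-regular graphs with arbitrarily large slope-number.)
   Context: Graphs are undirected, finite and simple. A geometric drawing of a graph represents each vertex by a distinct point in the plane $\mathbb{R}^2$ and each edge by the straight line segment between its endpoints, such that the only vertices an edge intersects are its own endpoints. The slope-number of a graph $G$ is the minimum number of distinct edge slopes in a geometric drawing of $G$ (slopes lie in $\mathbb{R}\cup\{\infty\}$). *)

(* Defs.v *)
From mathcomp Require Import all_boot all_order all_algebra.
From mathcomp Require Import boolp classical_sets set_interval reals.
From mathcomp Require Import ring.

Set Implicit Arguments.
Unset Strict Implicit.
Unset Printing Implicit Defensive.

Import Order.TTheory GRing.Theory Num.Theory.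
Local Open Scope ring_scope.

Record sgraph := SGraph {
  vertex :> finType;
  adj : rel vertex;
  adj_sym : symmetric adj;
  adj_irrefl : irreflexive adj }.

Definition regular (d : nat) (G : sgraph) : Prop :=
  forall v : G, #|[set w | adj v w]%SET| = d.

Definition segment (R : realType) (a b : R * R) : set (R * R) :=
  [set (line_path a.1 b.1 t, line_path a.2 b.2 t) | t in `[0, 1]]%classic.

(* Slopes live in R together with a point at infinity, encoded by [None]. *)
Definition slope (R : realType) (a b : R * R) : option R :=
  if a.1 == b.1 then None else Some ((b.2 - a.2) / (b.1 - a.1)).

Definition is_drawing (R : realType) (G : sgraph) (p : G -> R * R) : Prop :=
  injective p /\
  forall u v w : G,
    adj u v -> segment (p u) (p v) (p w) -> w = u \/ w = v.

(* Every edge occurs as two ordered pairs, harmlessly: for distinct points,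
   [slope a b = slope b a]. *)
Definition edge_slopes (R : realType) (G : sgraph) (p : G -> R * R) :
    seq (option R) :=
  undup [seq slope (p uv.1) (p uv.2) | uv in [pred e : G * G | adj e.1 e.2]].

Definition drawable_with (R : realType) (G : sgraph) (n : nat) : Prop :=
  exists2 p : G -> R * R, is_drawing p & size (edge_slopes p) = n.

Lemma slopeC (R : realType) (a b : R * R) : slope a b = slope b a.
Proof.
rewrite /slope eq_sym; case: ifP => // _; congr Some.
by rewrite -opprB -[b.1 - _]opprB invrN mulrNN.
Qed.

(* Points on a parabola are in general position. *)
Lemma drawing_exists (R : realType) (G : sgraph) :
  exists p : G -> R * R, is_drawing p.
Proof.
pose i (v : G) : R := (enum_rank v : nat)%:R.
have i_inj : injective i.
  by move=> u v /eqP; rewrite eqr_nat => /eqP/val_inj/enum_rank_inj.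
exists (fun v => (i v, i v ^+ 2)); split=> [u v [] /i_inj //|u v w uv].
case=> t _ /= [e1 e2].
have : (i w - i u) * (i w - i v) = 0.
  have -> : (i w - i u) * (i w - i v) =
            i w ^+ 2 - i w * (i u + i v) + i u * i v by ring.
  by rewrite -e2 -e1 /line_path; ring.
move/eqP; rewrite mulf_eq0 !subr_eq0.
by case/orP=> /eqP/i_inj; [left|right].
Qed.

Lemma drawable_with_exists (R : realType) (G : sgraph) :
  exists n, `[< drawable_with R G n >].
Proof.
have [p pd] := drawing_exists R G.
by exists (size (edge_slopes p)); apply/asboolP; exists p.
Qed.

Definition slope_number (R : realType) (G : sgraph) : nat :=
  ex_minn (drawable_with_exists R G).

Lemma slope_numberP (R : realType) (G : sgraph) :
  drawable_with R G (slope_number R G) /\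
  forall p : G -> R * R, is_drawing p ->
    (slope_number R G <= size (edge_slopes p))%N.
Proof.
rewrite /slope_number; case: ex_minnP => n /asboolP dn nmin; split=> // p pd.
by apply: nmin; apply/asboolP; exists p.
Qed.

(* Main.v *)
(** After Pach and Palvolgyi. Join the vertices of a fixed 4-regular frame, the
    square of a cycle of length [6 * n], by one of [n!] perfect matchings, and
    take the disjoint union of all [n!] resulting graphs. Fix a drawing of the
    union with at most [k] slopes. Consecutive triangles of the frame are
    nondegenerate, so the slopes of the frame edges determine each copy of the
    frame up to translation and scaling; the slope and orientation of a matching
    edge at [x] then determine the mate of [x], as the first vertex met in that
    direction. So the copies are told apart by labels with at most [C ^ n]
    values, [C] depending only on [k], which is less than [n!] for large [n].
    Larger degrees are obtained by a Cartesian product with a clique. *)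

Require Import Defs.
From mathcomp Require Import all_boot all_order all_algebra.
From mathcomp Require Import reals.
From mathcomp Require Import fingroup perm set_interval.
From mathcomp Require Import ring lra.

Set Implicit Arguments.
Unset Strict Implicit.
Unset Printing Implicit Defensive.

Import Order.TTheory GRing.Theory Num.Theory.
Local Open Scope ring_scope.

(** * Affine geometry of directions in the plane *)

Section Headings.
Variable R : realType.
Implicit Types a b c d : R * R.

Definition scaled (r : R) a b c d : Prop :=
  d.1 - c.1 = r * (b.1 - a.1) /\ d.2 - c.2 = r * (b.2 - a.2).

Lemma segment_scale a b c (t : R) : 0 <= t -> t <= 1 -> scaled t a b a c ->
  segment a b c.
Proof.
move=> t0 t1 [e1 e2]; exists t; first by rewrite /= in_itv /= t0 t1.
rewrite /line_path [c]surjective_pairing; congr pair; lra.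
Qed.

(** The hypotheses combine to [(c - r1) * (z - x) = (c - r2) * (z - y)] in each coordinate; two
    sides of a nondegenerate triangle are not parallel, so [c = r1]. *)
Lemma scaled_third_vertex x y z x' y' z' (c r1 r2 : R) :
  (y.1 - x.1) * (z.2 - x.2) != (y.2 - x.2) * (z.1 - x.1) ->
  scaled c x y x' y' -> scaled r1 x z x' z' -> scaled r2 y z y' z' ->
  scaled c x z x' z'.
Proof.
case: x y z x' y' z' => [x1 x2] [y1 y2] [z1 z2] [x1' x2'] [y1' y2'] [z1' z2'].
rewrite /scaled /= => det [c1 c2] [a1 a2] [b1 b2].
suff -> : c = r1 by [].
have e1 : (c - r1) * (z1 - x1) = (c - r2) * (z1 - y1) by lra.
have e2 : (c - r1) * (z2 - x2) = (c - r2) * (z2 - y2) by lra.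
have : (c - r1) * ((y1 - x1) * (z2 - x2) - (y2 - x2) * (z1 - x1)) = 0.
  have -> : (c - r1) * ((y1 - x1) * (z2 - x2) - (y2 - x2) * (z1 - x1)) =
    (c - r1) * (z1 - x1) * (z2 - y2) - (c - r1) * (z2 - x2) * (z1 - y1) by ring.
  by rewrite e1 e2; ring.
move/eqP; rewrite mulf_eq0 !subr_eq0 (negPf det) orbF.
by move/eqP.
Qed.

(* Together with the slope, the boolean orients the line through [a] and [b]. *)
Definition heading a b : option R * bool :=
  (slope a b, if a.1 == b.1 then a.2 < b.2 else a.1 < b.1).

Lemma ratio_gt0 (x y : R) : x != 0 -> y != 0 -> (0 < x) = (0 < y) -> 0 < y / x.
Proof.
move=> x0 y0 xy; case: (ltrP 0 x) => xs.
  by rewrite divr_gt0 // -xy.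
rewrite -mulrNN -invrN divr_gt0 // oppr_gt0 lt_neqAle ?x0 ?y0 //.
by rewrite leNgt -xy -leNgt.
Qed.

Lemma heading_eq a b c d : a != b -> c != d -> heading a b = heading c d ->
  exists2 r : R, 0 < r & scaled r a b c d.
Proof.
case: a b c d => [a1 a2] [b1 b2] [c1 c2] [d1 d2] ab cd.
rewrite /scaled /heading /slope /=.
case: (eqVneq a1 b1) ab => [<- ab|ab1 _];
  case: (eqVneq c1 d1) cd => [<- cd|cd1 _] //= -[].
  have ab2 : b2 - a2 != 0.
    by rewrite subr_eq0; apply: contraNneq ab => ->.
  have cd2 : d2 - c2 != 0.
    by rewrite subr_eq0; apply: contraNneq cd => ->.
  move=> s; exists ((d2 - c2) / (b2 - a2)).
    by apply: ratio_gt0 => //; rewrite !subr_gt0.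
  by rewrite !subrr mulr0 divfK.
have ab2 : b1 - a1 != 0 by rewrite subr_eq0 eq_sym.
have cd2 : d1 - c1 != 0 by rewrite subr_eq0 eq_sym.
move=> s; exists ((d1 - c1) / (b1 - a1)).
  by apply: ratio_gt0 => //; rewrite !subr_gt0.
rewrite divfK //; split=> //.
by rewrite mulrAC -mulrA s mulrC divfK.
Qed.

Lemma segment_of_collinear a b c : a != b ->
  (b.1 - a.1) * (c.2 - a.2) = (b.2 - a.2) * (c.1 - a.1) ->
  [\/ segment a b c, segment a c b | segment b c a].
Proof.
case: a b c => [a1 a2] [b1 b2] [c1 c2] /= ab col.
have [t [e1 e2]] : exists t, c1 - a1 = t * (b1 - a1) /\ c2 - a2 = t * (b2 - a2).
  case: (eqVneq a1 b1) ab => [e ab|ab1 _].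
    have ab2 : b2 - a2 != 0.
      by rewrite subr_eq0; apply: contraNneq ab => ->; rewrite e.
    exists ((c2 - a2) / (b2 - a2)); rewrite divfK //; split=> //.
    move/eqP: col; rewrite -e subrr mul0r mulr0 eq_sym mulf_eq0 (negPf ab2) /=.
    by move/eqP.
  have ab2 : b1 - a1 != 0 by rewrite subr_eq0 eq_sym.
  exists ((c1 - a1) / (b1 - a1)); rewrite divfK //; split=> //.
  apply: (mulfI ab2).
  by rewrite col [RHS]mulrA [X in _ = X * _]mulrC divfK // mulrC.
case: (lerP 0 t) => t0.
  case: (lerP t 1) => t1; first by apply: Or31; apply: (segment_scale t0 t1).
  (* For [t > 1], [b] divides the segment from [a] to [c] at parameter [1 / t]. *)
  have tp : t != 0 by rewrite gt_eqF //; lra.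
  apply: Or32; apply: (@segment_scale _ _ _ t^-1) => /=.
  - by rewrite invr_ge0.
  - by rewrite invf_le1 ?ltW //; lra.
  - by rewrite /scaled /= e1 e2 !mulKf.
(* For [t < 0], [a] divides the segment from [b] to [c] at parameter [1 / (1 - t)]. *)
have tp : 1 - t != 0 by rewrite gt_eqF //; lra.
apply: Or33; apply: (@segment_scale _ _ _ (1 - t)^-1) => /=.
- by rewrite invr_ge0; lra.
- by rewrite invf_le1; lra.
- by split; apply: (mulfI tp); rewrite mulVKf //=; lra.
Qed.

End Headings.

(** * Consequences of the drawing axioms *)

Section Drawings.
Variables (R : realType) (G : sgraph) (p : G -> R * R).
Hypothesis pd : is_drawing p.

Lemma adj_neq (x y : G) : adj x y -> x != y.
Proof. by apply: contraTneq => ->; rewrite adj_irrefl. Qed.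

Lemma drawing_neq (x y : G) : x != y -> p x != p y.
Proof. by case: pd => inj _ xy; apply: contraNneq xy => /inj->. Qed.

(** Otherwise one of the three vertices would lie on the edge joining the other two. *)
Lemma triangle_not_collinear (x y z : G) : adj x y -> adj y z -> adj x z ->
  ((p y).1 - (p x).1) * ((p z).2 - (p x).2) !=
  ((p y).2 - (p x).2) * ((p z).1 - (p x).1).
Proof.
move=> xy yz xz; apply/eqP => /segment_of_collinear.
have nxy := adj_neq xy; have nyz := adj_neq yz; have nxz := adj_neq xz.
have [_ on_edge] := pd.
case/(_ (drawing_neq nxy)) => /on_edge => [/(_ xy)|/(_ xz)|/(_ yz)] [] e;
  by rewrite e eqxx in nxy nyz nxz.
Qed.

Lemma edge_slopesP (x y : G) : adj x y -> slope (p x) (p y) \in edge_slopes p.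
Proof.
move=> xy; rewrite mem_undup; apply/mapP; exists (x, y) => //.
by rewrite mem_enum.
Qed.

End Drawings.

(** An optimal drawing of [H] restricts along [f] to a drawing of [G] with no new slopes. *)
Lemma slope_number_le (R : realType) (G H : sgraph) (f : G -> H) :
  injective f -> (forall x y, adj x y -> adj (f x) (f y)) ->
  (slope_number R G <= slope_number R H)%N.
Proof.
move=> f_inj f_adj; have [[p [p_inj p_seg] <-] _] := slope_numberP R H.
have [_ /(_ (p \o f)) min] := slope_numberP R G.
apply: (leq_trans (min _)).
  split=> [x y /p_inj/f_inj //|u v w /f_adj uv /(p_seg _ _ _ uv)].
  by case=> /f_inj; [left|right].
apply: uniq_leq_size; first exact: undup_uniq.
move=> s; rewrite mem_undup => /mapP[[x y]]; rewrite mem_enum => xy ->.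
exact/(edge_slopesP p)/f_adj.
Qed.

(** * The 5-regular graphs and their encoding by labels *)

Section FrameWithMatching.
Variable m : nat.
Notation n := m.+2.
Notation V := ('I_n * 'I_6)%type.
Implicit Types (x y : V) (s : {perm 'I_n}).

(* The frame is the square of the cycle of length [6 * n]; a vertex is written
   as its quotient and remainder by 6. *)
Definition next x : V := (if x.2 + 1 == 0 then x.1 + 1 else x.1, x.2 + 1).
Definition prev x : V := (if x.2 == 0 then x.1 - 1 else x.1, x.2 - 1).

(* Mates have remainders differing by 3, so that they are never adjacent in the
   frame. *)
Definition mate s x : V :=
  (if x.2 == 0 then s x.1 else if x.2 == 3 then (s^-1)%g x.1 else x.1, x.2 + 3).

Lemma nextK : cancel next prev.
Proof. by case=> a r; rewrite /prev /= addrK; case: eqP; rewrite ?addrK. Qed.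

Lemma prevK : cancel prev next.
Proof. by case=> a r; rewrite /next /= subrK; case: eqP; rewrite ?subrK. Qed.

Lemma mateK s : involutive (mate s).
Proof.
case=> a [[|[|[|[|[|[|//]]]]]] ri]; rewrite /mate /= ?permK ?permKV;
  congr pair; exact/val_inj.
Qed.

Lemma mate_inj s t : mate s =1 mate t -> s = t.
Proof. by move=> st; apply/permP => a; case: (st (a, 0)). Qed.

Definition neighbors s x : seq V :=
  [:: next x; next (next x); prev x; prev (prev x); mate s x].

(** The remainders of these six vertices are exactly the six residues modulo 6. *)
Lemma neighbors_uniq s x : uniq (x :: neighbors s x).
Proof.
apply: (@map_uniq _ _ snd).
by case: x => a [[|[|[|[|[|[|//]]]]]] ri].
Qed.

Lemma neighbors_sym s x y : (y \in neighbors s x) = (x \in neighbors s y).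
Proof.
suff imp u v : v \in neighbors s u -> u \in neighbors s v.
  by apply/idP/idP; apply: imp.
rewrite !inE; case/or4P=> [/eqP->|/eqP->|/eqP->|/orP[]/eqP->];
  by rewrite ?nextK ?prevK ?mateK eqxx ?orbT.
Qed.

(** Iterating [next] from [(0, 0)] reaches [(a, r)] after [r + a * 6] steps. Two base cases are
    needed because similarity spreads along triangles of consecutive vertices. *)
Lemma next_ind (P : V -> Prop) : P (0, 0) -> P (next (0, 0)) ->
  (forall x, P x -> P (next x) -> P (next (next x))) -> forall x, P x.
Proof.
move=> P0 P1 PS [a r].
have iterP j : P (iter j next (0, 0)) /\ P (iter j.+1 next (0, 0)).
  by elim: j => [//|j [Pj Pj1]]; split=> //; apply: PS.
have iter6 q b : iter (q * 6) next (b, 0) = (b + q%:R, 0).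
  elim: q b => [|q IHq] b; first by rewrite addr0.
  rewrite mulSn addnC iterD.
  have -> : iter 6 next (b, 0) = (b + 1, 0) by congr pair; apply: val_inj.
  by rewrite IHq -addrA nat1r.
have iter_r : iter r next (a, 0) = (a, r).
  case: r => [[|[|[|[|[|[|//]]]]]] ri]; congr pair; exact: val_inj.
by have [] := iterP (r + a * 6)%N; rewrite iterD iter6 add0r natr_Zp iter_r.
Qed.

Definition union_adj : rel ({perm 'I_n} * V) :=
  [rel u v | (u.1 == v.1) && (v.2 \in neighbors u.1 u.2)].

Lemma union_sym : symmetric union_adj.
Proof.
move=> [s x] [t y] /=; rewrite /union_adj /= eq_sym.
by case: eqP => // ->; rewrite neighbors_sym.
Qed.

Lemma union_irrefl : irreflexive union_adj.
Proof.
move=> [s x] /=; have := neighbors_uniq s x; rewrite /union_adj /= eqxx.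
by case/andP=> /negPf.
Qed.

Definition matching_union := SGraph union_sym union_irrefl.

Lemma matching_union_regular : regular 5 matching_union.
Proof.
move=> [s x] /=.
have /andP[_ uN] := neighbors_uniq s x.
transitivity (size [seq (s, y) | y <- neighbors s x]); last by [].
have : uniq [seq (s, y) | y <- neighbors s x].
  by rewrite map_inj_uniq // => y z [].
move/card_uniqP => <-; apply: eq_card => -[t y].
rewrite inE [LHS]/=; apply/idP/mapP => [/andP[/eqP /= <- yN]|[z zN [-> ->]]] /=.
  by exists y.
by rewrite /union_adj /= eqxx.
Qed.

Section Bound.
Variables (R : realType) (p : matching_union -> R * R) (k : nat).
Hypotheses (pd : is_drawing p) (pk : (size (edge_slopes p) <= k)%N).

Definition label s x y : 'I_k.+1 * bool :=
  let h := heading (p (s, x)) (p (s, y)) in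
  (inord (index h.1 (edge_slopes p)), h.2).

(** Slopes of edges occur in [edge_slopes p], so their indices determine them, and equal labels give
    equal headings. *)
Lemma label_eq s t x y z : y \in neighbors s x -> z \in neighbors t x ->
  label s x y = label t x z ->
  exists2 r : R, 0 < r &
    scaled r (p (s, x)) (p (s, y)) (p (t, x)) (p (t, z)).
Proof.
have lt_k c : (index c (edge_slopes p) < k.+1)%N.
  by rewrite ltnS (leq_trans (index_size _ _)).
move=> yN zN [/(congr1 val)]; rewrite !val_insubd !lt_k /= => eqs eqb.
have sy : @adj matching_union (s, x) (s, y) by rewrite /= /union_adj /= eqxx.
have tz : @adj matching_union (t, x) (t, z) by rewrite /= /union_adj /= eqxx.
apply: heading_eq.
- exact/(drawing_neq pd)/adj_neq.
- exact/(drawing_neq pd)/adj_neq.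
rewrite /heading eqb; congr pair.
rewrite -[LHS](nth_index None (edge_slopesP p sy)) eqs.
by rewrite nth_index // edge_slopesP.
Qed.

(** At [i = 2] the list is overrun and [nth] returns its default, the mate. *)
Definition labeling s : {ffun V -> {ffun 'I_3 -> 'I_k.+1 * bool}} :=
  [ffun x => [ffun i : 'I_3 => label s x
    (nth (mate s x) [:: next x; next (next x)] i)]].

Lemma labeling_inj : injective labeling.
Proof.
move=> s t st.
have labE i x : labeling s x i = labeling t x i by rewrite st.
have lab1 x : label s x (next x) = label t x (next x).
  by have := labE 0 x; rewrite !ffunE.
have lab2 x : label s x (next (next x)) = label t x (next (next x)).
  by have := labE 1 x; rewrite !ffunE.
have lab3 x : label s x (mate s x) = label t x (mate t x).
  by have := labE 2 x; rewrite !ffunE.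
have N1 u x : next x \in neighbors u x by rewrite !inE eqxx.
have N2 u x : next (next x) \in neighbors u x by rewrite !inE eqxx orbT.
have N3 u x : mate u x \in neighbors u x by rewrite !inE eqxx !orbT.
have adjN u x y : y \in neighbors u x -> @adj matching_union (u, x) (u, y).
  by move=> yN; rewrite /= /union_adj /= eqxx.
(* The first frame edge fixes the ratio [c] between the two copies; the triangles then propagate
   it. *)
have [c c0 c01] := label_eq (N1 s _) (N1 t _) (lab1 (0, 0)).
pose similar x := scaled c (p (s, (0, 0))) (p (s, x)) (p (t, (0, 0))) (p (t, x)).
have sim : forall x, similar x.
  apply: next_ind => //; first by split; rewrite !subrr mulr0.
  move=> x sx sy.
  have [r1 _ sxz] := label_eq (N2 s x) (N2 t x) (lab2 x).
  have [r2 _ syz] := label_eq (N1 s _) (N1 t _) (lab1 (next x)).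
  have sxy : scaled c (p (s, x)) (p (s, next x)) (p (t, x)) (p (t, next x)).
    by move: sx sy => [? ?] [? ?]; split; lra.
  have [] := scaled_third_vertex
    (triangle_not_collinear pd (adjN _ _ _ (N1 s x)) (adjN _ _ _ (N1 s _))
      (adjN _ _ _ (N2 s x))) sxy sxz syz.
  by move: sx => [? ?]; split; lra.
apply: mate_inj => x.
have mate_neq u : mate u x <> x.
  by move=> e; have /andP[/negP[]] := neighbors_uniq u x; rewrite -{1}e.
have [r r0 [e1 e2]] := label_eq (N3 s x) (N3 t x) (lab3 x).
have [[x1 x2] [y1 y2]] := conj (sim x) (sim (mate s x)).
have [z1 z2] := sim (mate t x).
have [_ on_edge] := pd.
(* Seen from [x], both mates lie in the same direction. The nearer one lies on the matching edge to
   the other: in copy [s] if [r <= c], in copy [t] otherwise. *)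
case: (lerP r c) => rc.
  have seg : segment (p (s, x)) (p (s, mate s x)) (p (s, mate t x)).
    apply: (@segment_scale _ _ _ _ (r / c)).
    - by rewrite divr_ge0 // ltW.
    - by rewrite ler_pdivrMr ?mul1r.
    - by split; rewrite mulrAC; apply: (canRL (mulfK (lt0r_neq0 c0))); lra.
  case: (on_edge _ _ _ (adjN _ _ _ (N3 s x)) seg) => /(congr1 snd) /=.
    by move/mate_neq.
  by [].
have seg : segment (p (t, x)) (p (t, mate t x)) (p (t, mate s x)).
  apply: (@segment_scale _ _ _ _ (c / r)).
  - by rewrite divr_ge0 // ltW.
  - by rewrite ler_pdivrMr ?mul1r // ltW.
  - have [f1 f2] : scaled c (p (s, x)) (p (s, mate s x))
        (p (t, x)) (p (t, mate s x)) by split; lra.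
    by rewrite /scaled f1 f2 e1 e2 !mulrA divfK ?lt0r_neq0.
case: (on_edge _ _ _ (adjN _ _ _ (N3 t x)) seg) => /(congr1 snd) /=.
  by move/mate_neq.
by [].
Qed.

(** There are [6 * n] vertices, each with three labels from a set of size [k.+1 * 2]. *)
Lemma perm_count_le : (n`! <= (((k.+1 * 2) ^ 3) ^ 6) ^ n)%N.
Proof.
rewrite -card_Sn; apply: leq_trans (leq_card _ labeling_inj) _.
by rewrite !card_ffun !card_prod !card_ord card_bool (mulnC _ 6) expnM.
Qed.

End Bound.

End FrameWithMatching.

(** With [M = C ^ 2 + 1], [C ^ (2 * M) < M ^ M <= (2 * M)!], the last because the [M] largest
    factors exceed [M]. *)
Lemma expn_lt_fact (C : nat) : exists n, (C ^ n.+2 < n.+2`!)%N.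
Proof.
pose M := (C ^ 2).+1.
have le_fact j : (M ^ j <= (M + j)`!)%N.
  elim: j => [|j IHj]; first exact: fact_gt0.
  by rewrite addnS factS expnS leq_mul // leqW ?leq_addr.
exists (C ^ 2 + C ^ 2)%N.
have -> : (C ^ 2 + C ^ 2).+2 = (M + M)%N by rewrite addnS addSn.
apply: leq_trans (le_fact M).
by rewrite addnn -mul2n expnM ltn_exp2r.
Qed.

Lemma slope_number_unbounded (R : realType) (k : nat) :
  exists2 G : sgraph, regular 5 G & (k < slope_number R G)%N.
Proof.
have [m lt_fact] := expn_lt_fact (((k.+1 * 2) ^ 3) ^ 6).
exists (matching_union m); first exact: matching_union_regular.
rewrite ltnNge; apply/negP => le_k.
have [[p pd size_p] _] := slope_numberP R (matching_union m).
rewrite -size_p in le_k.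
by have := perm_count_le pd le_k; rewrite leqNgt lt_fact.
Qed.

(** * Raising the degree *)

Section ProductWithClique.
Variables (G : sgraph) (d : nat).

Definition clique_adj : rel (G * 'I_d.+1) :=
  [rel u v | (u.1 == v.1) && (u.2 != v.2) || adj u.1 v.1 && (u.2 == v.2)].

Lemma clique_sym : symmetric clique_adj.
Proof.
move=> u v; rewrite /clique_adj /= adj_sym.
by rewrite ![_ == v.2]eq_sym ![_ == v.1]eq_sym.
Qed.

Lemma clique_irrefl : irreflexive clique_adj.
Proof. by move=> u; rewrite /clique_adj /= adj_irrefl !eqxx. Qed.

Definition clique_product := SGraph clique_sym clique_irrefl.

(** A vertex has [r] neighbors in its copy of [G] and, disjointly, [d] in its clique of [d.+1]
    vertices. *)
Lemma clique_product_regular r : regular r G -> regular (r + d)%N clique_product.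
Proof.
move=> Gr [u i] /=.
have -> : [set w | clique_adj (u, i) w]%SET =
    ([set (v, i) | v in [set v | adj u v]] :|: [set (u, j) | j in [set~ i]])%SET.
  apply/setP => -[v j]; rewrite !inE /clique_adj /= orbC; congr orb.
    apply/andP/imsetP => [[uv /eqP<-]|[w]]; first by exists v; rewrite ?inE.
    by rewrite inE => uw [-> ->].
  apply/andP/imsetP => [[/eqP<- ij]|[w]].
    by exists j; rewrite ?inE // eq_sym.
  by rewrite !inE eq_sym => iw [-> ->].
rewrite cardsU disjoint_setI0 ?cards0 ?subn0.
  rewrite !card_imset ?Gr; try by move=> ? ? [].
  by rewrite cardsC1 card_ord.
rewrite -setI_eq0; apply/eqP/setP => -[v j]; rewrite !inE.
apply/negP => /andP[/imsetP[w _ [_ ->]] /imsetP[l]].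
by rewrite !inE => li [_ il]; rewrite il eqxx in li.
Qed.

End ProductWithClique.

Theorem theorem2 (R : realType) (Delta : nat) (hDelta : (5 <= Delta)%N) (k : int) :
  exists G : sgraph, regular Delta G /\ (k < (slope_number R G)%:Z)%R.
Proof.
have [G G5 ltG] := slope_number_unbounded R `|k|.
exists (clique_product G (Delta - 5)%N); split.
  by have := clique_product_regular (d := Delta - 5) G5; rewrite subnKC.
apply: (le_lt_trans (ler_norm k)); rewrite -abszE ltz_nat (leq_trans ltG) //.
(* The layer at [ord0] is a copy of [G]. *)
apply: (@slope_number_le _ G (clique_product G _) (fun x => (x, ord0))).
  by move=> x y [].
move=> x y xy.
by rewrite /= /clique_adj /= xy eqxx orbT.
Qed.
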